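(* Let $\kappa\geq\aleph_0$ be a cardinal, and let $\alpha_i$ be an ordinal with $2\leq\alpha_i<\omega_1$ for all $i\in\kappa$. Then $P^{top}(\alpha_i)_{i\in\kappa}=\kappa^+$.
   Context: Ordinals carry the order topology, subsets the subspace topology. $P^{top}(\alpha_i)_{i\in\kappa}$ is the least ordinal $\beta$ such that for every $c:\beta\to\kappa$ there exist $i\in\kappa$ and $X\subseteq c^{-1}(\{i\})$ homeomorphic to $\alpha_i$ ($\infty$ if none exists). $\kappa^+$ is the cardinal successor of $\kappa$. *)

(* Defs.v *)
From HB Require Import structures.
From mathcomp Require Import all_boot all_order.
From mathcomp Require Import boolp wochoice classical_sets functions cardinality.
From mathcomp Require Import topology.

Set Implicit Arguments.
Unset Strict Implicit.
Unset Printing Implicit Defensive.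

Import Order.TTheory.

Local Open Scope classical_set_scope.
Local Open Scope order_scope.
Local Open Scope card_scope.

(* An ordinal is represented by a well-ordered type, considered up to order
   isomorphism; an element x of the carrier stands for the ordinal {y | y < x}. *)
Record Ord := MkOrd {
  ord_display : Order.disp_t;
  ord_sort :> orderType ord_display;
  ord_wo : well_order (<=%O : rel ord_sort) }.

Definition ord_le (a b : Ord) : Prop :=
  exists f : a -> b, {mono f : x y / x <= y} /\
    forall x y, y <= f x -> range f y.

Definition ord_lt (a b : Ord) : Prop :=
  exists (f : a -> b) (y0 : b), {mono f : x y / x <= y} /\
    range f = [set y | y < y0].

Section Comparability.
Context (a b : Ord).

Lemma ord_min (c : Ord) (P : set c) : P !=set0 ->
  exists2 m, P m & forall x, x < m -> ~ P x.
Proof.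
move=> [x0 Px0]; have [|m [[mP mle] _]] := @ord_wo c [pred x | `[< P x >]].
  by exists x0; apply/asboolP.
exists m; first exact/asboolP.
move=> x xm Px; have /mle : x \in [pred x | `[< P x >]] by exact/asboolP.
by rewrite leNgt xm.
Qed.

(* [match_ord x y]: the initial segments below x and y are isomorphic. *)
Inductive match_ord : a -> b -> Prop := MatchOrd x y :
  (forall x', x' < x -> exists2 y', y' < y & match_ord x' y') ->
  (forall y', y' < y -> exists2 x', x' < x & match_ord x' y') ->
  match_ord x y.

Lemma match_l x y : match_ord x y ->
  forall x', x' < x -> exists2 y', y' < y & match_ord x' y'.
Proof. by case. Qed.

Lemma match_r x y : match_ord x y ->
  forall y', y' < y -> exists2 x', x' < x & match_ord x' y'.
Proof. by case. Qed.

Lemma match_fun x y z : match_ord x y -> match_ord x z -> y = z.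
Proof.
move: x y z.
have H x y z : match_ord x y -> match_ord x z -> ~ y < z.
  move=> xy xz yz.
  have [|m [u [v [mu mv uv]]] mmin] := @ord_min a
    [set x | exists u v, [/\ match_ord x u, match_ord x v & u < v]].
    by exists x, y, z.
  have [m' m'm m'u] := match_r mv uv.
  have [w wu m'w] := match_l mu m'm.
  by apply: (mmin m' m'm); exists w, u.
move=> x y z xy xz; have [yz|zy|//] := ltgtP y z.
  by case: (H x y z).
by case: (H x z y).
Qed.

Lemma match_inj x z y : match_ord x y -> match_ord z y -> x = z.
Proof.
move: x z y.
have H x z y : match_ord x y -> match_ord z y -> ~ x < z.
  move=> xy zy xz; have [w wy xw] := match_l zy xz.
  by move: wy; rewrite (match_fun xw xy) ltxx.
move=> x z y xy zy; have [xz|zx|//] := ltgtP x z.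
  by case: (H x z y).
by case: (H z x y).
Qed.

Lemma ord_leVlt : ord_le a b \/ ord_lt b a.
Proof.
have [dom|/existsNP ndom] := pselect (forall x, exists y, match_ord x y).
  left; have [f fP] := choice dom; exists f; split.
    apply: le_mono => x y xy; have [z zfy xz] := match_l (fP y) xy.
    by rewrite (match_fun (fP x) xz).
  move=> x y; rewrite le_eqVlt => /orP[/eqP->|/(match_r (fP x))[z _ zy]].
    by exists x.
  by exists z => //; exact: match_fun zy.
right; have [|x0 nx0 x0min] := @ord_min a [set x | ~ exists y, match_ord x y].
  by case: ndom => x ?; exists x.
have dom0 x : x < x0 -> exists y, match_ord x y by move/x0min/contrapT.
have rng y : exists x, match_ord x y.
  apply: contrapT => ny.
  have [|y0 ny0 y0min] := @ord_min b [set y | ~ exists x, match_ord x y].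
    by exists y.
  apply: (nx0); exists y0; apply: MatchOrd => [x xx0|z zy0].
    have [z xz] := dom0 _ xx0; exists z => //.
    rewrite ltNge; apply/negP; rewrite le_eqVlt => /orP[/eqP e|lt].
      by apply: ny0; exists x; rewrite e.
    by have [w _ ?] := match_r xz lt; apply: ny0; exists w.
  have [x xz] := contrapT (y0min _ zy0); exists x => //.
  rewrite ltNge; apply/negP; rewrite le_eqVlt => /orP[/eqP e|lt].
    by apply: nx0; exists z; rewrite e.
  by have [w _ ?] := match_l xz lt; apply: nx0; exists w.
have [g gP] := choice rng; exists g, x0; split.
  apply: le_mono => x y xy; have [z zfy xz] := match_r (gP y) xy.
  by rewrite (match_inj (gP x) xz).
apply/seteqP; split=> [_ [y _ <-]|x /= xx0].
  rewrite /= ltNge; apply/negP; rewrite le_eqVlt => /orP[/eqP e|lt].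
    by apply: nx0; exists y; rewrite e.
  by have [w _ ?] := match_l (gP y) lt; apply: nx0; exists w.
have [y xy] := dom0 _ xx0; exists y => //; exact: match_inj (gP y) xy.
Qed.

End Comparability.

Lemma well_order_nat : well_order (<=%O : rel nat).
Proof.
apply: antisymmetric_well_order; first exact: le_anti.
move=> A [n An]; have exA : exists n, n \in A by exists n.
by exists (ex_minn exA); case: ex_minnP => m Am mmin; split=> // x /mmin.
Qed.

Lemma well_order_I n : well_order (<=%O : rel 'I_n).
Proof.
apply: antisymmetric_well_order; first exact: le_anti.
move=> A [i Ai]; case: (@arg_minnP _ i [in A] (@nat_of_ord n) Ai) => m Am mmin.
by exists m; split=> // x /mmin.
Qed.

Definition ord_omega : Ord := MkOrd well_order_nat.
Definition ord_nat (n : nat) : Ord := MkOrd (@well_order_I n).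

(* Cardinals are initial ordinals. *)
Definition is_cardinal (k : Ord) : Prop :=
  forall a : Ord, ord_lt a k -> ~ ([set: a] #= [set: k]).

Definition is_card_succ (k m : Ord) : Prop :=
  [/\ is_cardinal m, ord_lt k m &
      forall n, is_cardinal n -> ord_lt k n -> ord_le m n].

Fact wo_display : Order.disp_t. Proof. exact: Order.Disp tt tt. Qed.

Section OrdOfRel.
Context (T : choiceType) (R : rel T) (woR : well_order R).

Definition wo_carrier (_ : well_order R) : Type := T.
Local Notation W := (wo_carrier woR).
HB.instance Definition _ := Choice.on W.

Let total_R : total R.
Proof. by move=> x y; exact: (wo_chainW (withinW (A := predT) woR)). Qed.

Let anti_R : antisymmetric R.
Proof.
move=> x y /andP[xy yx].
have rr z : R z z by have := total_R z z; rewrite orbb.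
have [|m [_ mu]] := woR (A := pred2 x y); first by exists x; rewrite inE eqxx.
by rewrite -(mu x) ?(mu y)//; split=> [|z]; rewrite !inE ?eqxx ?orbT//;
  move=> /orP[] /eqP->.
Qed.

Let trans_R : transitive R.
Proof.
move=> y x z xy yz.
have [|m [[/or3P[] /eqP-> mle] _]] := woR (A := [pred u | [|| u == x, u == y | u == z]]).
- by exists x; rewrite inE eqxx.
- by apply: mle; rewrite inE eqxx !orbT.
- have yx : R y x by apply: mle; rewrite inE eqxx.
  by rewrite (anti_R (introT andP (conj xy yx))).
- have zy : R z y by apply: mle; rewrite inE eqxx !orbT.
  by rewrite -(anti_R (introT andP (conj yz zy))).
Qed.

Let refl_R : reflexive R.
Proof. by move=> x; have := total_R x x; rewrite orbb. Qed.

HB.instance Definition _ :=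
  @Order.Le_isPOrder.Build wo_display W R refl_R anti_R trans_R.
HB.instance Definition _ :=
  @Order.POrder_isTotal.Build wo_display W total_R.

Definition ord_of_rel : Ord := @MkOrd _ (W : orderType _) woR.
End OrdOfRel.

Section Hartogs.
Context (k : Ord).

Let inj_into (T : Type) := exists f : T -> k, injective f.

Let power : Ord := ord_of_rel (projT2 (well_ordering_principle (set k))).

(* The elements of the well-ordered power set of [k] having at most [k]
   predecessors form an initial segment, which is the successor of [k]. *)
Let small (x : power) : bool := `[< inj_into {z : power | z < x} >].

Let H := {x : power | small x}.

Let leH (x y : H) : bool := val x <= val y.

Let woH : well_order leH.
Proof.
apply: antisymmetric_well_order => [x y /le_anti|A [x Ax]]; first exact: val_inj.
have [|m [u Au um] mmin] := @ord_min power [set z | exists2 u : H, u \in A & val u = z].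
  by exists (val x), x.
exists u; split=> // v Av; rewrite /leH leNgt um; apply/negP => /mmin.
by apply; exists v.
Qed.

Let Hord : Ord := ord_of_rel woH.

Let Hord_large : ~ inj_into H.
Proof.
move=> [f fi].
have [|m nsm mmin] := @ord_min power [set x | ~ small x].
  apply: contrapT => /forallNP all_small.
  have sm (x : power) : small x by apply: contrapT; exact: all_small.
  pose g (A : set k) : k := f (exist small (A : power) (sm A)).
  have gi : injective g by move=> A B /fi [].
  pose D : set k := [set y | exists2 A : set k, y = g A & ~ A y].
  have [DgD|nDgD] := pselect (D (g D)).
    by have [A /gi DA nA] := DgD; apply: nA; rewrite -DA.
  by apply: (nDgD); exists D.
apply: nsm; apply/asboolP.
have sm (z : {z : power | z < m}) : small (val z).
  by apply: contrapT; apply: mmin; exact: valP z.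
exists (fun z => f (exist small (val z) (sm z))) => z1 z2 /fi [] e.
exact: val_inj.
Qed.

Let Hord_lt (a : Ord) : ord_lt a Hord -> inj_into a.
Proof.
move=> [f [y0 [fmono fr]]].
have [g gi] : inj_into {z : power | z < val (y0 : H)} by exact/asboolP/(valP (y0 : H)).
have lt0 x : val (f x : H) < val (y0 : H).
  have : range f (f x) by exists x.
  by rewrite fr /= !ltNge.
exists (fun x => g (exist (fun z : power => z < val (y0 : H)) _ (lt0 x))) => x y /gi [] /val_inj e.
exact: (inc_inj fmono).
Qed.

Let eq_inj (a b : Ord) : [set: a] #= [set: b] -> exists f : b -> a, injective f.
Proof.
rewrite card_eq_sym => /asboolP[f].
exists (fun x => val (f (exist _ x (mem_setT x)))) => x y /val_inj.
by move=> /(@inj _ _ _ f _ _ (mem_setT _) (mem_setT _)) [].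
Qed.

Lemma card_succ_exists : exists m, is_card_succ k m.
Proof.
have idi : inj_into k by exists id.
exists Hord; split.
- move=> a /Hord_lt [f fi] /eq_inj[g gi]; apply: Hord_large.
  by exists (f \o g) => x y /fi /gi.
- have [[f [fmono _]]|//] := ord_leVlt Hord k.
  by case: Hord_large; exists f; exact: inc_inj fmono.
move=> n ncard kn; have [//|/Hord_lt [f fi]] := ord_leVlt Hord n.
case: (ncard _ kn); rewrite card_eq_le.
have [g [y0 [gmono _]]] := kn.
have le (a b : Ord) (h : a -> b) : injective h -> [set: a] #<= [set: b].
  move=> hi; apply: inj_card_le.
  have /Pinj[h' _] : set_inj [set: a] h by move=> x y _ _ /hi.
  exact: 'totalfun_[set: a] h'.
by apply/andP; split; [apply: (le k n g); exact: inc_inj|exact: (le n k f)].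
Qed.

End Hartogs.

Definition card_succ (k : Ord) : Ord := projT1 (cid (card_succ_exists k)).

Lemma card_succP (k : Ord) : is_card_succ k (card_succ k).
Proof. exact: projT2 (cid (card_succ_exists k)). Qed.

Definition ord_omega1 : Ord := card_succ ord_omega.

Definition homeomorphic (X Y : topologicalType) : Prop :=
  exists (f : X -> Y) (g : Y -> X),
    [/\ cancel f g, cancel g f, continuous f & continuous g].

Definition top_space (a : Ord) : topologicalType := order_topology a.

Definition top_arrow (k b : Ord) (alpha : k -> Ord) : Prop :=
  forall c : b -> k, exists (i : k) (X : set (top_space b)),
    X `<=` c @^-1` [set i] /\
    homeomorphic (set_type X) (top_space (alpha i)).

(* [is_Ptop alpha b] reads "P^top(alpha_i)_{i in k} = b"; it determines [b] up
   to order isomorphism, and no [b] satisfies it when P^top is infinite. *)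
Definition is_Ptop (k : Ord) (alpha : k -> Ord) (b : Ord) : Prop :=
  top_arrow b alpha /\ forall b', top_arrow b' alpha -> ord_le b b'.

(* Main.v *)
(* If b < kappa^+, an injective colouring b -> kappa has no monochromatic set
   with two points.  For the upper bound, let S_i be the colour classes of
   c : kappa^+ -> kappa.  Call x in alpha_i good if S_i contains arbitrarily
   high images of [0, x] under strictly increasing continuous maps.  As kappa^+
   is regular and the alpha_i are countable, there are d_0 bounding the witnesses
   of all non-good pairs (i, x) and d_0 < d_1 < ... such that, for every good
   pair, such an image lies between d_n and d_(n+1).  Let z = sup d_n and
   i = c z.  If every y < x is good, concatenating countably many images of
   initial segments of [0, x) and adding z on top gives an image of [0, x] above
   d_0, so x is good.  Hence all of alpha_i is good, and one more concatenation
   embeds alpha_i as a subspace of S_i. *)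
Require Import Defs.
From mathcomp Require Import all_boot all_order.
From mathcomp Require Import boolp wochoice classical_sets functions cardinality.
From mathcomp Require Import interval set_interval topology.

Set Implicit Arguments.
Unset Strict Implicit.
Unset Printing Implicit Defensive.

Import Order.TTheory.

Local Open Scope classical_set_scope.
Local Open Scope order_scope.
Local Open Scope card_scope.

(** * Comparison of cardinalities by injections *)

Definition embeds (T U : Type) : Prop := exists f : T -> U, injective f.

Lemma embeds_trans T U V : embeds T U -> embeds U V -> embeds T V.
Proof. by move=> [f fi] [g gi]; exists (g \o f); exact: inj_comp. Qed.

Lemma embeds_prod T U T' U' :
  embeds T T' -> embeds U U' -> embeds (T * U) (T' * U').
Proof.
move=> [f fi] [g gi]; exists (fun p => (f p.1, g p.2)) => -[x y] [x' y'] /=.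
by move=> [] /fi -> /gi ->.
Qed.

(** Hilbert's hotel: shifting the copy [e] of the naturals by one frees [e 0] for [None]. *)
Lemma embeds_option T : embeds nat T -> embeds (option T) T.
Proof.
move=> [e ei].
have /choice[s sP] (x : T) : exists y, (forall n, x = e n -> y = e n.+1) /\
    ((forall n, x <> e n) -> y = x).
  have [[n xn]|nx] := pselect (exists n, x = e n).
    exists (e n.+1); split=> [m|/(_ n)//].
    by rewrite xn => /ei ->.
  by exists x; split=> // n xn; case: nx; exists n.
have si : injective s.
  move=> x y.
  have [[n xn]|/forallNP nx] := pselect (exists n, x = e n);
    have [[m ym]|/forallNP ny] := pselect (exists n, y = e n).
  - by rewrite ((sP x).1 _ xn) ((sP y).1 _ ym) xn ym => /ei [->].
  - by rewrite ((sP x).1 _ xn) ((sP y).2 ny) => h; case: (ny n.+1).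
  - by rewrite ((sP x).2 nx) ((sP y).1 _ ym) => h; case: (nx m.+1).
  - by rewrite ((sP x).2 nx) ((sP y).2 ny).
have s0 x : s x <> e 0%N.
  have [[n xn]|/forallNP nx] := pselect (exists n, x = e n).
    by rewrite ((sP x).1 _ xn) => /ei.
  by rewrite ((sP x).2 nx); exact: nx.
exists (fun o => if o is Some x then s x else e 0%N) => -[x|] [y|] //=.
- by move/si ->.
- by move/s0.
- by move/esym/s0.
Qed.

Lemma embeds_card_le T U : embeds T U <-> [set: T] #<= [set: U].
Proof.
split=> [[f fi]|].
  apply: inj_card_le; have /Pinj[g _] : set_inj [set: T] f by move=> x y _ _ /fi.
  exact: 'totalfun_[set: T] g.
move=> /card_leP[f].
exists (fun x => val (f (exist _ x (in_setT x)))) => x y /val_inj.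
by move=> /(@inj _ _ _ f _ _ (in_setT _) (in_setT _)) [].
Qed.

Lemma embeds_nat_infinite T : embeds nat T <-> infinite_set [set: T].
Proof. by rewrite embeds_card_le infiniteP. Qed.

Lemma ord_le_embeds (a b : Ord) : ord_le a b -> embeds a b.
Proof. by move=> [f [fm _]]; exists f; exact: inc_inj. Qed.

Lemma ord_lt_embeds (a b : Ord) : ord_lt a b -> embeds a b.
Proof. by move=> [f [y [fm _]]]; exists f; exact: inc_inj. Qed.

(** * Initial segments and squares of infinite ordinals *)

Section Segment.
Context (a : Ord) (x : a).

Definition seg_le (u v : {y : a | y < x}) : bool := val u <= val v.

Lemma seg_wo : well_order seg_le.
Proof.
apply: antisymmetric_well_order => [u v /le_anti|A [u Au]]; first exact: val_inj.
have [|m [w Aw wm] mmin] := @ord_min a [set z | exists2 u, u \in A & val u = z].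
  by exists (val u), u.
exists w; split=> // v Av; rewrite /seg_le leNgt wm; apply/negP => /mmin.
by apply; exists v.
Qed.

Definition seg : Ord := ord_of_rel seg_wo.

Definition seg_val (u : seg) : a := val (u : {y : a | y < x}).

Lemma seg_valP (u : seg) : seg_val u < x.
Proof. exact: (valP (u : {y : a | y < x})). Qed.

Lemma seg_val_mono : {mono seg_val : u v / u <= v}.
Proof. by []. Qed.

Lemma seg_val_inj : injective seg_val.
Proof. exact: inc_inj seg_val_mono. Qed.

Lemma seg_lt : ord_lt seg a.
Proof.
exists seg_val, x; split=> //.
apply/seteqP; split=> [_ [u _ <-]|y yx]; first exact: seg_valP.
by exists (exist _ y yx).
Qed.

Lemma embeds_seg T (f : T -> a) :
  injective f -> (forall t, f t < x) -> embeds T seg.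
Proof.
move=> fi fx; exists (fun t => exist (fun y => y < x) (f t) (fx t)) => s t [].
exact: fi.
Qed.

End Segment.

Lemma seg_segE (a : Ord) (m : a) (u : seg m) :
  embeds (seg u) (seg (seg_val u)) /\ embeds (seg (seg_val u)) (seg u).
Proof.
split.
  have inj2 : injective (fun v : seg u => seg_val (seg_val v)).
    by move=> v w /seg_val_inj /seg_val_inj.
  by apply: (embeds_seg inj2) => v; rewrite /= (leW_mono (@seg_val_mono _ _)) seg_valP.
have vm (v : seg (seg_val u)) : seg_val v < m.
  exact: lt_trans (seg_valP v) (seg_valP u).
apply: (@embeds_seg _ _ _ (fun v => exist (fun y => y < m) (seg_val v) (vm v) : seg m)).
  by move=> v w [] /seg_val_inj.
by move=> v; rewrite -(leW_mono (@seg_val_mono _ _) _ u); exact: (seg_valP v).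
Qed.

Lemma ord_lt_seg (a b : Ord) : ord_lt a b -> exists x : b, embeds a (seg x).
Proof.
move=> [f [x [fm fr]]]; exists x.
have fx u : f u < x.
  by have : range f (f u) by [exists u]; rewrite fr.
exact: embeds_seg (inc_inj fm) fx.
Qed.

(** The composite [g \o f] is strictly increasing and moves [x0] down, but the least point moved
    down would be sent to a smaller such point. *)
Lemma ord_le_lt_false (a b : Ord) : ord_le a b -> ord_lt b a -> False.
Proof.
move=> [f [fm _]] [g [x0 [gm gr]]].
have hlt x y : x < y -> g (f x) < g (f y) by rewrite (leW_mono gm) (leW_mono fm).
have [|m mP mmin] := @ord_min a [set x | g (f x) < x].
  by exists x0; have : range g (g (f x0)) by [exists (f x0)]; rewrite gr.
by apply: (mmin _ mP); exact: hlt.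
Qed.

(* The square is well-ordered by maximum first, so that proper initial
   segments lie in a square {y | y <= m}^2. *)
Section Square.
Context (a : Ord).

Let mx (p : a * a) : a := Order.max p.1 p.2.

Let sq_le (p q : a * a) : bool :=
  (mx p < mx q) || (mx p == mx q) && ((p.1 < q.1) || (p.1 == q.1) && (p.2 <= q.2)).

Let sq_le_mx p q : sq_le p q -> mx p <= mx q.
Proof. by case/orP=> [/ltW//|/andP[/eqP->]]. Qed.

Let sq_wo : well_order sq_le.
Proof.
apply: antisymmetric_well_order => [[p1 p2] [q1 q2]|A [p Ap]].
  rewrite /sq_le /= (eq_sym (mx (q1, q2))) (eq_sym q1).
  by case: ltgtP => //= _; case: ltgtP => //= -> /le_anti ->.
have [|m [q Aq qm] mmin] := @ord_min a [set z | exists2 q, q \in A & mx q = z].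
  by exists (mx p), p.
have [|m1 [r Ar [rm r1]] m1min] :=
  @ord_min a [set z | exists2 q, q \in A & mx q = m /\ q.1 = z].
  by exists q.1, q.
have [|m2 [t At [tm t1 t2]] m2min] :=
  @ord_min a [set z | exists2 q, q \in A & [/\ mx q = m, q.1 = m1 & q.2 = z]].
  by exists r.2, r.
exists t; split=> // u Au; rewrite /sq_le tm t1 t2.
case: (ltgtP m (mx u)) => //= [um|mu].
  by case: (mmin _ um); exists u.
case: (ltgtP m1 u.1) => //= [u1|mu1].
  by case: (m1min _ u1); exists u.
rewrite leNgt; apply/negP => u2.
by case: (m2min _ u2); exists u.
Qed.

(** If the square is longer than [a], then [a] is its segment below some pair [w], and all pairs
    there have entries at most the maximum of [w]. *)
Lemma square_leVseg : embeds (a * a) a \/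
  exists m : a, embeds a ({y : a | y <= m} * {y : a | y <= m}).
Proof.
have [/ord_le_embeds|[f [w [fm fr]]]] := ord_leVlt (ord_of_rel sq_wo) a.
  by left.
right; exists (mx w).
have fw u : sq_le (f u) w.
  have : range f (f u) by exists u.
  by rewrite fr /= => /ltW.
have f1 u : (f u).1 <= mx w.
  by apply: le_trans (sq_le_mx (fw u)); rewrite le_max lexx.
have f2 u : (f u).2 <= mx w.
  by apply: le_trans (sq_le_mx (fw u)); rewrite le_max lexx orbT.
exists (fun u => (exist (fun y => y <= mx w) _ (f1 u), exist (fun y => y <= mx w) _ (f2 u))).
move=> u v [e1 e2]; apply: (inc_inj fm).
by move: e1 e2; case: (f u) (f v) => ? ? [? ?] /= -> ->.
Qed.

End Square.

Lemma initial_embeds_option (a : Ord) (m : a) :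
  embeds {y : a | y <= m} (option (seg m)).
Proof.
pose g (y : {y : a | y <= m}) : option {y : a | y < m} := insub (val y).
exists (g : _ -> option (seg m)) => -[x xm] [y ym]; rewrite /g /= => e.
apply: val_inj => /=; move: e; case: insubP => [u _ <-|xm'];
  case: insubP => [v _ <-|ym'] //; first by move=> [->].
move=> _; apply/le_anti.
by move: xm' ym'; rewrite -!leNgt => mx my; rewrite (le_trans xm) ?(le_trans ym).
Qed.

(** Induction on segments. If the square of [b] did not embed, [b] would embed in the square of some
    [{y | y <= m}]; for infinite [seg m] the induction hypothesis then puts [b], hence its square,
    into [seg m]. *)
Lemma square_embeds (a : Ord) : embeds nat a -> embeds (a * a) a.
Proof.
have step (b : Ord) : embeds nat b ->
    (forall x : b, embeds nat (seg x) -> embeds (seg x * seg x) (seg x)) ->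
    embeds (b * b) b.
  move=> natb IH; have [//|[m bm]] := square_leVseg b.
  have [natm|nnat] := pselect (embeds nat (seg m)).
    have leb : embeds {y : b | y <= m} (seg m).
      exact: embeds_trans (initial_embeds_option m) (embeds_option natm).
    have bs : embeds b (seg m).
      exact: embeds_trans bm (embeds_trans (embeds_prod leb leb) (IH m natm)).
    apply: embeds_trans (embeds_prod bs bs) (embeds_trans (IH m natm) _).
    exact/ord_lt_embeds/seg_lt.
  (* A finite [seg m] would make [b] finite. *)
  exfalso; move/embeds_nat_infinite: (natb); apply.
  have fin : finite_set [set: {y : b | y <= m}].
    have fo : finite_set [set: option (seg m)].
      have -> : [set: option (seg m)] = None |` Some @` [set: seg m].
        by apply/seteqP; split=> // -[x|] _; [right; exists x|left].
      rewrite finite_setU; split; first exact: finite_set1.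
      apply: finite_image; apply: contrapT => inf; apply: nnat.
      exact/embeds_nat_infinite.
    by apply: card_le_finite fo; exact/embeds_card_le/initial_embeds_option.
  have := finite_setX fin fin; apply: card_le_finite.
  by rewrite setXTT; exact/embeds_card_le.
move=> nata; apply: (step) => // x natx.
apply: contrapT => nx; have [|m [natm nm] mmin] := @ord_min a
  [set x | embeds nat (seg x) /\ ~ embeds (seg x * seg x) (seg x)].
  by exists x.
(* [step] now serves for the least counterexample; minimality of [m] gives its induction hypothesis,
   carried over to segments of [seg m]. *)
apply: nm; apply: (step) => // u natu.
have [le ge] := seg_segE u.
have IH : embeds (seg (seg_val u) * seg (seg_val u)) (seg (seg_val u)).
  apply: contrapT => nIH; apply: (mmin _ (seg_valP u)); split=> //.
  exact: embeds_trans natu le.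
exact: embeds_trans (embeds_prod le le) (embeds_trans IH ge).
Qed.

(** * Size and regularity of successor cardinals *)

(** The segment below the least counterexample would be a cardinal above [k], yet shorter than
    [card_succ k]. *)
Lemma seg_card_succ_embeds (k : Ord) (x : card_succ k) : embeds (seg x) k.
Proof.
have [_ _ succ_min] := card_succP k.
apply: contrapT => nx; have [|m nm mmin] := @ord_min (card_succ k)
  [set x | ~ embeds (seg x) k].
  by exists x.
have small b : ord_lt b (seg m) -> embeds b k.
  move=> /ord_lt_seg[u bu]; apply: contrapT => nb.
  apply: (mmin _ (seg_valP u)) => /(embeds_trans (seg_segE u).1).
  by move/(embeds_trans bu).
apply: (ord_le_lt_false _ (seg_lt m)); apply: succ_min => [b /small bk eqb|].
  apply: nm; apply: embeds_trans bk; apply/embeds_card_le.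
  by move: eqb; rewrite card_eq_le => /andP[].
by have [/ord_le_embeds|] := ord_leVlt (seg m) k.
Qed.

Lemma ord_lt_card_succ (k a : Ord) : ord_lt a (card_succ k) -> embeds a k.
Proof.
by move=> /ord_lt_seg[x ax]; exact: embeds_trans ax (seg_card_succ_embeds x).
Qed.

Lemma card_succ_not_embeds (k : Ord) : ~ embeds (card_succ k) k.
Proof.
have [succ_card klt _] := card_succP k.
move=> /embeds_card_le le; apply: (succ_card _ klt).
by rewrite card_eq_le le andbT; exact/embeds_card_le/ord_lt_embeds.
Qed.

(** For unbounded [h], each [b] is determined by some [i] with [b <= h i] and by its place among the
    at most [k] points up to [h i]. This embeds [card_succ k] in [k * k], hence in [k]. *)
Lemma card_succ_regular (k : Ord) (I : Type) (h : I -> card_succ k) :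
  embeds nat k -> embeds I k -> exists b, forall i, h i < b.
Proof.
move=> natk [j ji]; apply: contrapT => /forallNP unb.
have /choice[i iP] (b : card_succ k) : exists i, b <= h i.
  by have /existsNP[i /negP] := unb b; rewrite -leNgt; exists i.
apply: (@card_succ_not_embeds k).
have sgo (z : card_succ k) : embeds {y : card_succ k | y <= z} k.
  apply: embeds_trans (initial_embeds_option z) _.
  apply: embeds_trans (embeds_option natk).
  have [s si] := seg_card_succ_embeds z.
  by exists (omap s); exact: inj_omap.
pose s z := projT1 (cid (sgo z)).
have sP z : injective (s z) := projT2 (cid (sgo z)).
apply: embeds_trans (square_embeds natk).
exists (fun b => (j (i b), s (h (i b)) (exist (fun y => y <= h (i b)) b (iP b)))).
move=> b c [/ji]; move: (iP b) (iP c) => + + ibc; rewrite -ibc => bi ci.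
by move/sP => -[].
Qed.

(** * The lower bound *)

Lemma homeomorphic_embeds (X Y : topologicalType) :
  homeomorphic X Y -> embeds Y X.
Proof. by move=> [f [g [fK gK _ _]]]; exists g; exact: can_inj gK. Qed.

Lemma top_arrow_large (k b : Ord) (alpha : k -> Ord) :
  (forall i, ord_le (ord_nat 2) (alpha i)) ->
  top_arrow b alpha -> ~ embeds b k.
Proof.
move=> ge2 ba [c ci]; have [i [X [Xc /homeomorphic_embeds[g gi]]]] := ba c.
have /ord_le_embeds[f fi] := ge2 i.
have gX (u : alpha i) : c (val (g u)) = i.
  by apply: Xc; apply: set_valP.
(* [ord0] and [ord_max] are the two points of [ord_nat 2]; their images share the colour [i], so an
   injective colouring identifies them. *)
have : g (f ord0) = g (f ord_max).
  by apply: val_inj; apply: ci; rewrite !gX.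
by move=> /gi /fi.
Qed.

(** * Normal maps and concatenation of copies *)

Section NormalMaps.
Context (a b : Ord).
Implicit Types (D : set a) (S : set b) (f : a -> b).

(* The second clause is continuity from the left; in a well-order, continuity
   from the right is automatic. *)
Definition normal_on D f : Prop :=
  (forall x y, D x -> D y -> x < y -> f x < f y) /\
  (forall x u, D x -> u < f x -> (exists w, w < x) ->
     exists2 w, w < x & forall y, w < y -> y <= x -> u < f y).

(** The bounds are strict, so copies in consecutive intervals follow one another. For a lower set
    [D], the values of [f] off [D] do not matter. *)
Definition copy D S (l h : b) : Prop :=
  exists f, normal_on D f /\ forall y, D y -> [/\ S (f y), l < f y & f y < h].

Lemma copy_weaken D S l l' h h' : l' <= l -> h <= h' ->
  copy D S l h -> copy D S l' h'.
Proof.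
move=> ll' hh' [f [fn fP]]; exists f; split=> // y /fP[Sy ly yh].
by split=> //; [exact: le_lt_trans ly|exact: lt_le_trans hh'].
Qed.

Lemma finite_lt_bound (x : a) (e : nat -> a) (n : nat) :
  (exists w, w < x) -> (forall m, (m < n)%N -> e m < x) ->
  exists2 w, w < x & forall m, (m < n)%N -> e m <= w.
Proof.
move=> [w0 w0x]; elim: n => [|n IH] ex; first by exists w0.
have [m mn|w wx ew] := IH; first by apply: ex; exact: ltnW.
exists (Order.max w (e n)); first by rewrite gt_max wx ex.
move=> m; rewrite ltnS leq_eqVlt => /orP[/eqP->|/ew ?]; rewrite le_max.
  by rewrite lexx orbT.
by apply/orP; left.
Qed.

Section Concatenation.
Context (D : set a) (S : set b) (e : nat -> a) (d : nat -> b).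
Hypotheses (D_lower : forall x y, x <= y -> D y -> D x)
  (e_cofinal : forall y, D y -> exists n, y <= e n)
  (d_inc : forall n, d n < d n.+1)
  (pieces : forall n, copy [set y | y <= e n] S (d n) (d n.+1)).

Lemma inc_seq_le m n : (m <= n)%N -> d m <= d n.
Proof.
elim: n => [|n IH]; first by rewrite leqn0 => /eqP->.
rewrite leq_eqVlt => /orP[/eqP-> //|]; rewrite ltnS => /IH dmn.
exact: le_trans dmn (ltW (d_inc n)).
Qed.

(* On [(sup_(k < n) e k, e n]] use the [n]-th piece. *)
Lemma concatenation : exists f, [/\ normal_on D f,
  forall y, D y -> S (f y) /\ (exists n, f y < d n) &
  forall y m, D y -> (forall k, (k < m)%N -> e k < y) -> d m < f y].
Proof.
have [p pP] := choice pieces.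
(* [n y] is the least index with [y <= e n], so the piece used at [y]; 0 is a dummy value off
   [D]. *)
have /choice[n nP] y : exists n, D y -> y <= e n /\ forall k, (k < n)%N -> e k < y.
  have [Dy|nDy] := pselect (D y); last by exists 0%N.
  have exn : exists n, y <= e n by exact: e_cofinal.
  exists (ex_minn exn) => _; case: ex_minnP => m ym mmin; split=> // k km.
  by rewrite ltNge; apply/negP => /mmin; rewrite leqNgt km.
have nmono x y : D y -> x <= y -> (n x <= n y)%N.
  move=> Dy xy; rewrite leqNgt; apply/negP => nxy.
  have [_ /(_ _ nxy)] := nP _ (D_lower xy Dy).
  by rewrite ltNge (le_trans xy (nP _ Dy).1).
have pB y : D y -> [/\ S (p (n y) y), d (n y) < p (n y) y & p (n y) y < d (n y).+1].
  by move=> /nP[yn _]; apply: (pP (n y)).2.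
exists (fun y => p (n y) y); split; [split|..].
- move=> x y Dx Dy xy; have := nmono _ _ Dy (ltW xy).
  rewrite leq_eqVlt => /orP[/eqP nxy|nxy].
    rewrite nxy; apply: (pP (n y)).1.1 => //=; last exact: (nP _ Dy).1.
    exact: le_trans (ltW xy) (nP _ Dy).1.
  have [_ _ xd] := pB _ Dx; have [_ yd _] := pB _ Dy.
  exact: lt_trans xd (le_lt_trans (inc_seq_le nxy) yd).
- move=> x u Dx ux xmin; have [xn nx] := nP _ Dx.
  have [w wx wP] := (pP (n x)).1.2 x u xn ux xmin.
  have [v vx vP] := finite_lt_bound xmin nx.
  (* Staying above [v], hence above every earlier [e k], keeps [y] in the piece of [x], which is
     continuous from the left. *)
  exists (Order.max w v) => [|y]; first by rewrite gt_max wx vx.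
  rewrite gt_max => /andP[wy vy] yx; have Dy := D_lower yx Dx.
  suff -> : n y = n x by exact: wP.
  apply/eqP; rewrite eqn_leq nmono //= leqNgt; apply/negP => /vP.
  by rewrite leNgt (lt_le_trans vy) // (nP _ Dy).1.
- by move=> y /pB[Sy _ yd]; split=> //; exists (n y).+1.
- move=> y m Dy my; have [_ yd _] := pB _ Dy; apply: le_lt_trans yd.
  apply: inc_seq_le; rewrite leqNgt; apply/negP => /my.
  by rewrite ltNge (nP _ Dy).1.
Qed.

End Concatenation.

(** Since [l] is the supremum of the [d n], a concatenation over the points below [x] extends
    continuously by sending [x] to [l]. *)
Lemma copy_top (x : a) S (d : nat -> b) (l h : b) :
  embeds a nat -> S l -> l < h ->
  (forall n, d n < d n.+1) -> (forall n, d n < l) ->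
  (forall u, u < l -> exists n, u <= d n) ->
  (forall y, y < x -> forall n, copy [set z | z <= y] S (d n) (d n.+1)) ->
  copy [set y | y <= x] S (d 0%N) h.
Proof.
move=> [r ri] Sl lh d_inc dl d_sup pieces.
have [[y0 y0x]|xmin] := pselect (exists w, w < x); last first.
  have minE y : y <= x -> y = x.
    rewrite le_eqVlt => /orP[/eqP//|yx]; case: xmin; by exists y.
  exists (fun=> l); split=> [|//]; split=> [y z /minE-> /minE->|y u /minE->].
    by rewrite ltxx.
  by move=> _ /xmin.
(* [e] enumerates the points below [x] through [r], with default [y0]. *)
have /choice[e eP] n : exists y, y < x /\ forall z, z < x -> r z = n -> y = z.
  have [[z [zx zn]]|nz] := pselect (exists z, z < x /\ r z = n).
    by exists z; split=> // z' _; rewrite -zn => /ri.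
  by exists y0; split=> // z zx zn; case: nz; exists z.
have [y z yz zx|y yx|n|f [[finc fcont] fS fd]] :=
  @concatenation [set y | y < x] S e d _ _ d_inc _.
- exact: le_lt_trans zx.
- by exists (r y); rewrite ((eP (r y)).2 _ yx).
- exact: pieces (eP n).1 _.
have fl y : y < x -> f y < l.
  by move=> /fS[_ [n]] /lt_trans; apply.
exists (fun y => if y < x then f y else l); split; [split|].
- move=> y z /= yx zx yz; rewrite (lt_le_trans yz zx); case: ifP => zx'.
    by apply: finc => //=; exact: lt_trans zx'.
  by apply: fl; exact: lt_le_trans zx.
- move=> y u /=; rewrite le_eqVlt => /orP[/eqP->|yx].
    (* Continuity at [x]: beyond [e 0], ..., [e (m - 1)] all values exceed [d m], hence [u]. *)
    rewrite ltxx => /d_sup[m um] _.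
    have [k _|w wx wP] := @finite_lt_bound x e m (ex_intro _ y0 y0x).
      exact: (eP k).1.
    exists w => // z wz _; case: ifP => zx; last exact: le_lt_trans (dl m).
    apply: le_lt_trans um _; apply: fd => // k /wP kw.
    exact: le_lt_trans wz.
  rewrite yx => /(fcont _ _ yx) /[apply] -[w wy wP]; exists w => // z wz zy.
  by rewrite (le_lt_trans zy yx) wP.
- move=> y /= _; case: ifP => yx; last by split.
  by have [Sy _] := fS _ yx; split=> //; [exact: fd|exact: lt_trans (fl _ yx) lh].
Qed.

End NormalMaps.

(** * From normal maps to homeomorphisms *)

(** Open intervals form a base, and each is a ray, an intersection of two rays, or the whole
    space. *)
Lemma continuous_rays (T : topologicalType) (a : Ord) (h : T -> top_space a) :
  (forall w : a, open (h @^-1` [set y : a | w < y])) ->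
  (forall w : a, open (h @^-1` [set y : a | y < w])) -> continuous h.
Proof.
move=> hgt hlt x U; rewrite itv_nbhsE => -[i [io xi] iU].
suff : nbhs x (h @^-1` [set` i]) by apply: filterS => y /iU.
apply: open_nbhs_nbhs; split=> //; move: io {xi iU}.
case: i => [[[]t1|[]] [[]t2|[]]] //= _.
- rewrite (_ : _ @^-1` _ =
    (h @^-1` [set y : a | t1 < y]) `&` (h @^-1` [set y : a | y < t2])).
    exact: openI.
  by apply/seteqP; split=> y; rewrite /= in_itv /= => /andP.
- rewrite (_ : _ @^-1` _ = h @^-1` [set y : a | t1 < y]); first exact: hgt.
  by apply/seteqP; split=> y; rewrite /= in_itv /= andbT.
- rewrite (_ : _ @^-1` _ = h @^-1` [set y : a | y < t2]); first exact: hlt.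
  by apply/seteqP; split=> y; rewrite /= in_itv.
- rewrite (_ : _ @^-1` _ = setT); first exact: openT.
  by apply/seteqP.
Qed.

(** A proper lower set is the open ray below its least non-member. *)
Lemma lower_set_open (a : Ord) (D : set (top_space a)) :
  (forall x y : a, x <= y -> D y -> D x) -> open D.
Proof.
move=> Dl; have [->|/eqP/setTPn nD] := pselect (D = setT); first exact: openT.
have [m nm mmin] := @ord_min a (~` D) nD.
rewrite (_ : D = [set` `]-oo, (m : top_space a)[]); first exact: lray_open.
apply/seteqP; split=> [y Dy|y]; rewrite /= in_itv /=.
  by rewrite ltNge; apply/negP => my; exact: nm (Dl _ _ my Dy).
by move=> /mmin /contrapT.
Qed.

(** Preimages of lower rays are lower sets. For upper rays, left continuity handles the points up to
    [x] and monotonicity those after it. *)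
Lemma normal_continuous (a b : Ord) (f : a -> b) :
  normal_on setT f -> continuous (f : top_space a -> top_space b).
Proof.
move=> [finc fcont]; have fmono : {mono f : x y / x <= y}.
  by apply: le_mono => x y; exact: finc.
apply: continuous_rays => u.
  rewrite openE => x /= ux.
  have [[w wx]|xmin] := pselect (exists w, w < x).
    have [v vx vP] := fcont x u I ux (ex_intro _ w wx).
    apply: filterS (open_nbhs_nbhs (conj (@rray_open _ (top_space a) v) _)).
      move=> y; rewrite /= in_itv /= andbT => vy.
      have [yx|xy] := leP y x; first exact: vP.
      exact: lt_trans ux (finc _ _ I I xy).
    by rewrite /= in_itv /= andbT.
  apply: filterS filterT => y _ /=; apply: lt_le_trans ux _.
  by rewrite fmono leNgt; apply/negP => yx; apply: xmin; exists y.
apply: lower_set_open => x y xy /= yu; apply: le_lt_trans yu.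
by rewrite fmono.
Qed.

(** The inverse is continuous because rays at [w] pull back to traces of rays at [f w]. *)
Lemma normal_homeomorphic (a b : Ord) (f : a -> b) : normal_on setT f ->
  homeomorphic (set_type (range f : set (top_space b))) (top_space a).
Proof.
move=> fn; have [finc _] := fn.
have fmono : {mono f : x y / x <= y} by apply: le_mono => x y; exact: finc.
have fltE := leW_mono fmono.
have /choice[g gP] (u : set_type (range f : set (top_space b))) :
    exists x, f x = set_val u.
  by have [x _] := set_valP u; exists x.
have fr x : f x \in (range f : set (top_space b)) by apply/mem_set; exists x.
exists g, (fun x => SigSub (fr x)); split.
- by move=> u; apply: val_inj; exact: gP.
- by move=> x; apply: (inc_inj fmono); exact: gP.
- apply: continuous_rays => w.
    exists [set` `](f w : top_space b), +oo[]; first exact: rray_open.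
    by apply/seteqP; split=> u; rewrite /= in_itv /= andbT -gP fltE.
  exists [set` `]-oo, (f w : top_space b)[]; first exact: lray_open.
  by apply/seteqP; split=> u; rewrite /= in_itv /= -gP fltE.
- apply/continuousP => _ [B Bo <-].
  by move/continuousP: (normal_continuous fn) => /(_ _ Bo).
Qed.

(** * The upper bound and the theorem *)

Lemma top_arrow_card_succ (k : Ord) (alpha : k -> Ord) :
  embeds nat k -> (forall i, inhabited (alpha i)) ->
  (forall i, embeds (alpha i) nat) -> top_arrow (card_succ k) alpha.
Proof.
move=> natk alpha0 alphaN c.
pose S i : set (card_succ k) := [set z | c z = i].
pose good i x := forall l, exists h, copy [set y : alpha i | y <= x] (S i) l h.
have [_ [_ [z0 _]] _] := card_succP k.
have [embb embu] : embeds bool k /\ embeds unit k.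
  split; apply: embeds_trans natk; first by exists nat_of_bool => -[] [].
  by exists (fun=> 0%N) => -[] [].
(* Regularity is used twice: over the countable [alpha i], then over the colours. *)
have bound2 (h : forall i, alpha i -> card_succ k) : exists b, forall i x, h i x < b.
  have /choice[b1 b1P] i : exists b, forall x, h i x < b.
    by apply: (card_succ_regular _ natk); exact: embeds_trans (alphaN i) natk.
  have [|b bP] := card_succ_regular b1 natk _; first by exists id.
  by exists b => i x; exact: lt_trans (b1P i x) (bP i).
have [d0 d0P] : exists d0, forall i x, good i x \/
    forall h, ~ copy [set y : alpha i | y <= x] (S i) d0 h.
  have hP i x : exists l, good i x \/
      forall h, ~ copy [set y : alpha i | y <= x] (S i) l h.
    have [gx|/existsNP[l /forallNP nl]] := pselect (good i x); last first.
      by exists l; right.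
    by exists z0; left.
  have [d0 d0P] := bound2 (fun i => projT1 (choice (hP i))); exists d0 => i x.
  have [|nl] := projT2 (choice (hP i)) x; first by left.
  right=> h /(copy_weaken (ltW (d0P i x)) (lexx h)); exact: nl.
have /choice[next nextP] l : exists h, l < h /\ forall i x, good i x ->
    copy [set y : alpha i | y <= x] (S i) l h.
  have hP i x : exists h, good i x -> copy [set y : alpha i | y <= x] (S i) l h.
    have [/(_ l)[h lh]|ng] := pselect (good i x); first by exists h.
    by exists z0.
  have [u uP] := bound2 (fun i => projT1 (choice (hP i))).
  (* The two-element family yields one [v] above both [u] and [l]. *)
  have [v vP] := card_succ_regular (fun b : bool => if b then u else l) natk embb.
  exists v; split=> [|i x gx]; first exact: (vP false).
  exact: copy_weaken (lexx l) (ltW (lt_trans (uP i x) (vP true))) (projT2 (choice (hP i)) x gx).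
pose d n := iter n next d0.
have d_inc n : d n < d n.+1 by exact: (nextP (d n)).1.
have [t tP] := card_succ_regular d natk natk.
have [|z zP zmin] := @ord_min (card_succ k) [set z | forall n, d n < z].
  by exists t.
have z_sup u : u < z -> exists n, u <= d n.
  by move=> /zmin /existsNP[n /negP]; rewrite -leNgt; exists n.
(* Any point above [z] will do as the upper bound of a copy with top [z]. *)
have [h hP] := card_succ_regular (fun _ : unit => z) natk embu.
pose i := c z.
have good_all x : good i x.
  apply: contrapT => ngx.
  have [|m nm mmin] := @ord_min (alpha i) [set x | ~ good i x]; first by exists x.
  (* The copy topped by [z] lies above [d0], which the choice of [d0] excludes for the non-good
     [m]. *)
  have [//|] := d0P i m; apply; apply: copy_top (alphaN i) _ (hP tt) d_inc zP z_sup _ => //.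
  by move=> y /mmin /contrapT gy n; exact: (nextP (d n)).2.
have [r ri] := alphaN i; have [y0] := alpha0 i.
have /choice[e eP] n : exists y, forall x, r x = n -> y = x.
  have [[x xn]|nx] := pselect (exists x, r x = n).
    by exists x => y; rewrite -xn => /ri.
  by exists y0 => x xn; case: nx; exists x.
have [//|y _|n|f [fn fS _]] := @concatenation (alpha i) _ setT (S i) e d _ _ d_inc _.
- by exists (r y); rewrite (eP _ y).
- exact: (nextP (d n)).2.
exists i, (range f : set (top_space (card_succ k))); split.
  by move=> _ [x _ <-]; exact: (fS x I).1.
exact: normal_homeomorphic.
Qed.

Theorem theorem4p19 (kappa : Ord) (alpha : kappa -> Ord)
  (kappa_card : is_cardinal kappa)
  (kappa_inf : ord_le ord_omega kappa)
  (alpha_ge2 : forall i : kappa, ord_le (ord_nat 2) (alpha i))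
  (alpha_lt1 : forall i : kappa, ord_lt (alpha i) ord_omega1) :
  is_Ptop alpha (card_succ kappa).
Proof.
split=> [|b' arrow].
  apply: top_arrow_card_succ => [|i|i].
  - exact: ord_le_embeds kappa_inf.
  - by have [f _] := alpha_ge2 i; split; exact: f ord0.
  (* [ord_omega1] is by definition the successor of [ord_omega], so each [alpha i] is countable. *)
  - exact: ord_lt_card_succ (alpha_lt1 i).
have [//|/ord_lt_card_succ lt] := ord_leVlt (card_succ kappa) b'.
by case: (top_arrow_large alpha_ge2 arrow lt).
Qed.
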